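(* Let $a>1$ be fixed and let $\mu,\nu\in C_w^k[0,\infty)$ be twice differentiable with $\mu',\mu'',\nu',\nu''\in C_w^k[0,\infty)$. Then for each $x\ge 0$, $$\lim_{m\to\infty} m\left(\hat{\mathcal{R}}_{m,a}(\mu\nu;x)-\hat{\mathcal{R}}_{m,a}(\mu;x)\,\hat{\mathcal{R}}_{m,a}(\nu;x)\right)=x\,\mu'(x)\,\nu'(x).$$
   Context: For fixed $a>1$, $m\in\mathbb{N}=\{1,2,\dots\}$ and $x\ge 0$, the modified Szász-Mirakjan-Kantorovich operators are $$\hat{\mathcal{R}}_{m,a}(f;x)=m\sum_{k=0}^{\infty}s_{m,k}^a(x)\int_{k/m}^{(k+1)/m}f(t)\,dt,\qquad s_{m,k}^a(x)=a^{-x/(a^{1/m}-1)}\,\frac{x^k(\log a)^k}{(a^{1/m}-1)^k\,k!},$$ with $\log$ the natural logarithm (and $0^0=1$). Let $w(x)=1+x^2$. $B_w[0,\infty)$ is the set of functions $g:[0,\infty)\to\mathbb{R}$ with $|g(x)|\le M w(x)$ for all $x\ge0$, for some constant $M>0$ depending on $g$; $C_w[0,\infty)$ is the set of continuous $g\in B_w[0,\infty)$; and $C_w^k[0,\infty)$ is the set of $g\in C_w[0,\infty)$ for which $\lim_{x\to\infty}|g(x)|/w(x)$ exists and is finite (the superscript $k$ is only part of the notation). *)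

(* Defs.v *)
From Stdlib Require Import Reals Factorial.
From Coquelicot Require Import Coquelicot.
Open Scope R_scope.

(** Functions on [0, oo) are represented by total functions [R -> R]; none of the
    notions below depends on their values at negative arguments.  In particular
    continuity and differentiability on [0, oo) are relative to that set, hence
    one-sided at 0. *)
Definition half_line (x : R) : Prop := 0 <= x.

Definition derivative_on_half_line (f df : R -> R) : Prop :=
  forall x : R, half_line x -> D_in f df half_line x.

Definition w (x : R) : R := 1 + x ^ 2.

Definition Bw (g : R -> R) : Prop :=
  exists M : R, 0 < M /\ forall x : R, half_line x -> Rabs (g x) <= M * w x.

Definition Cw (g : R -> R) : Prop :=
  Bw g /\ forall x : R, half_line x -> continue_in g half_line x.

Definition Cwk (g : R -> R) : Prop :=
  Cw g /\ ex_finite_lim (fun x : R => Rabs (g x) / w x) p_infty.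

(** As [pow] satisfies [0 ^ 0 = 1], the case [x = 0] needs no separate treatment. *)
Definition basis (a : R) (m k : nat) (x : R) : R :=
  Rpower a (- x / (Rpower a (1 / INR m) - 1)) *
  ((x ^ k * ln a ^ k) / ((Rpower a (1 / INR m) - 1) ^ k * INR (fact k))).

(** Only [1 <= m] is meaningful. *)
Definition SMK (a : R) (m : nat) (f : R -> R) (x : R) : R :=
  INR m *
  Series (fun k : nat =>
    basis a m k x * RInt f (INR k / INR m) ((INR k + 1) / INR m)).

(* Main.v *)
Require Import Defs.
From Stdlib Require Import Reals Factorial Lra Lia.
From Coquelicot Require Import Coquelicot.
Open Scope R_scope.

(** The operator is [E f(T)] with [T = (K + U) / m], [K] a Poisson variable of
    parameter [lam = x ln a / (a^(1/m) - 1)] and [U] uniform on [0, 1], so the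
    quantity of interest is [m] times the covariance of [mu(T)] and [nu(T)].  This
    covariance is that of the increments [P = mu - mu(x)] and [Q = nu - nu(x)].
    With [d = t - x], differentiability at [x] and quadratic growth give
    [|P - mu'(x) d| <= eps |d| + K d^2] on the whole half-line, hence
    [|PQ - mu'(x) nu'(x) d^2| <= eps' d^2 + K' d^4].  The explicit moments satisfy
    [m E d^2 -> x] and [m E d^4 -> 0], which gives
    [m E[PQ] -> x mu'(x) nu'(x)], while [sqrt m E P] and [sqrt m E Q] tend to 0. *)

(** * Poisson weights and their moments up to order four *)

Definition poisson (lam : R) (k : nat) : R := exp (- lam) * (lam ^ k / INR (fact k)).

Lemma poisson_ge0 (lam : R) (k : nat) : 0 <= lam -> 0 <= poisson lam k.
Proof.
intros H; unfold poisson.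
apply Rmult_le_pos; [apply Rlt_le, exp_pos|].
apply Rmult_le_pos; [now apply pow_le|].
apply Rlt_le, Rinv_0_lt_compat, INR_fact_lt_0.
Qed.

Lemma is_series_poisson (lam : R) : is_series (poisson lam) 1.
Proof.
replace 1 with (exp (- lam) * exp lam)
  by (rewrite <- exp_plus, Rplus_opp_l; apply exp_0).
apply (is_series_scal (K := R_AbsRing) (V := R_NormedModule) (exp (- lam)) (fun k => lam ^ k / INR (fact k)) (exp lam)).
generalize (is_exp_Reals lam); unfold is_pseries; apply is_series_ext.
intros n; unfold scal; simpl; unfold mult; simpl; rewrite pow_n_pow.
reflexivity.
Qed.

(* E[K g(K)] = lam E[g(K + 1)] for a Poisson variable K. *)
Lemma poisson_stein (lam : R) (g : nat -> R) (l : R) :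
  is_series (fun k => poisson lam k * g (S k)) l ->
  is_series (fun k => poisson lam k * (INR k * g k)) (lam * l).
Proof.
intros H.
(* The term of index 0 vanishes thanks to the factor [INR k]; in the shifted terms [INR (S k)]
   cancels against the factorial, leaving one factor [lam]. *)
apply is_series_decr_1.
match goal with |- is_series _ ?v => replace v with (scal lam l) end.
2:{ unfold scal, plus, opp; simpl; unfold mult; simpl; ring. }
apply (is_series_ext (fun k => scal lam (poisson lam k * g (S k)))).
- intros k; unfold scal; simpl; unfold mult; simpl.
  unfold poisson; rewrite fact_simpl, mult_INR.
  change (lam ^ S k) with (lam * lam ^ k).
  change (match k with 0%nat => 1 | S _ => INR k + 1 end) with (INR (S k)).
  field; split; [apply INR_fact_neq_0 | apply not_0_INR; discriminate].
- now apply (is_series_scal (K := R_AbsRing) (V := R_NormedModule) lam).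
Qed.

(** The multipliers of [c1] to [c4] are the Touchard polynomials. Iterating [poisson_stein] gives
    the factorial moments, and powers are linear combinations of falling factorials. *)
Lemma is_series_poisson_poly4 (lam c0 c1 c2 c3 c4 : R) :
  is_series
    (fun k => poisson lam k *
       (c0 + c1 * INR k + c2 * INR k ^ 2 + c3 * INR k ^ 3 + c4 * INR k ^ 4))
    (c0 + c1 * lam + c2 * (lam ^ 2 + lam) + c3 * (lam ^ 3 + 3 * lam ^ 2 + lam)
     + c4 * (lam ^ 4 + 6 * lam ^ 3 + 7 * lam ^ 2 + lam)).
Proof.
pose (E (g : R -> R) (l : R) := is_series (fun k => poisson lam k * g (INR k)) l).
assert (ext : forall g h l l', E g l -> (forall t, g t = h t) -> l = l' -> E h l').
{ intros g h l l' H e <-; apply (is_series_ext _ _ _ (fun k => f_equal _ (e (INR k)))), H. }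
assert (lin : forall c g h l l', E g l -> E h l' -> E (fun t => c * g t + h t) (c * l + l')).
{ intros c g h l l' Hg Hh.
  apply (is_series_ext (fun k => plus (scal c (poisson lam k * g (INR k)) )
                                      (poisson lam k * h (INR k)))).
  - intros k; change (c * (poisson lam k * g (INR k)) + poisson lam k * h (INR k)
      = poisson lam k * (c * g (INR k) + h (INR k))); ring.
  - apply (is_series_plus (K := R_AbsRing) (V := R_NormedModule)); [|exact Hh].
    apply (is_series_scal (K := R_AbsRing) (V := R_NormedModule) c), Hg. }
assert (stein : forall g l, E (fun t => g (t + 1)) l -> E (fun t => t * g t) (lam * l)).
{ intros g l H; apply (poisson_stein lam (fun k => g (INR k))).
  apply is_series_ext with (2 := H); intros k; now rewrite S_INR. }
assert (E0 : E (fun _ => 1) 1).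
{ apply is_series_ext with (2 := is_series_poisson lam); intros k; simpl; ring. }
(* Factorial moments: E[K (K-1) ... (K-j+1)] = lam^j. *)
assert (E1 := stein (fun _ => 1) _ E0).
assert (E2 : E (fun t => t * (t - 1)) (lam * (lam * 1))).
{ apply (stein (fun t => t - 1)); eapply ext; [exact E1| |reflexivity]; intros t; cbv beta; ring. }
assert (E3 : E (fun t => t * ((t - 1) * (t - 2))) (lam * (lam * (lam * 1)))).
{ apply (stein (fun t => (t - 1) * (t - 2))); eapply ext; [exact E2| |reflexivity];
    intros t; cbv beta; ring. }
assert (E4 : E (fun t => t * ((t - 1) * ((t - 2) * (t - 3)))) (lam * (lam * (lam * (lam * 1))))).
{ apply (stein (fun t => (t - 1) * ((t - 2) * (t - 3)))); eapply ext; [exact E3| |reflexivity];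
    intros t; cbv beta; ring. }
(* The coefficients 1, 6, 7, 1 and 1, 3, 1 are Stirling numbers of the second kind. Since [lin] ends
   with a summand of coefficient 1, the constant [c0] is split as [(c0 - 1) + 1]. *)
assert (H := lin c4 _ _ _ _ E4 (lin (c3 + 6 * c4) _ _ _ _ E3
  (lin (c2 + 3 * c3 + 7 * c4) _ _ _ _ E2 (lin (c1 + c2 + c3 + c4) _ _ _ _ E1
  (lin (c0 - 1) _ _ _ _ E0 E0))))).
apply (ext _ (fun t => c0 + c1 * t + c2 * t ^ 2 + c3 * t ^ 3 + c4 * t ^ 4) _ _ H).
- intros t; cbv beta; ring.
- ring.
Qed.

(** * The operator as a Poisson expectation: linearity, domination, moments *)

Definition rate (a : R) (m : nat) (x : R) : R := x * ln a / (Rpower a (1 / INR m) - 1).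

(** [Series] and [RInt] are total, so a value of [SMK] alone does not certify convergence. This
    relation carries integrability and summability, which linearity requires; with [INR m] inside
    the sum, each weight multiplies a cell average of [f]. *)
Definition has_SMK (a : R) (m : nat) (f : R -> R) (x l : R) : Prop :=
  (forall k, ex_RInt f (INR k / INR m) ((INR k + 1) / INR m)) /\
  is_series (fun k => basis a m k x *
    (INR m * RInt f (INR k / INR m) ((INR k + 1) / INR m))) l.

Lemma has_SMK_unique (a : R) (m : nat) (f : R -> R) (x l : R) :
  has_SMK a m f x l -> SMK a m f x = l.
Proof.
intros [_ H]; rewrite <- (is_series_unique _ _ H).
unfold SMK; rewrite <- Series_scal_l; apply Series_ext; intros k; ring.
Qed.

Lemma has_SMK_ext (a : R) (m : nat) (f g : R -> R) (x l l' : R) :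
  has_SMK a m f x l -> (forall t, f t = g t) -> l = l' -> has_SMK a m g x l'.
Proof.
intros [Hi Hs] E <-; split.
- intros k; apply (ex_RInt_ext f); [now intros t _ | apply Hi].
- apply is_series_ext with (2 := Hs); intros k.
  do 2 f_equal; apply RInt_ext; now intros t _.
Qed.

Lemma has_SMK_lin (a : R) (m : nat) (f g : R -> R) (x c lf lg : R) :
  has_SMK a m f x lf -> has_SMK a m g x lg ->
  has_SMK a m (fun t => c * f t + g t) x (c * lf + lg).
Proof.
intros [If Sf] [Ig Sg]; split.
- intros k; apply (ex_RInt_plus (V := R_NormedModule) (fun t => c * f t) g); [|apply Ig].
  apply (ex_RInt_scal (V := R_NormedModule) f), If.
- apply (is_series_ext (fun k => plus
    (scal c (basis a m k x * (INR m * RInt f (INR k / INR m) ((INR k + 1) / INR m))))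
    (basis a m k x * (INR m * RInt g (INR k / INR m) ((INR k + 1) / INR m))))).
  + intros k.
    rewrite (RInt_plus (V := R_CompleteNormedModule) (fun t => c * f t) g);
      [|apply (ex_RInt_scal (V := R_NormedModule) f), If|apply Ig].
    rewrite (RInt_scal (V := R_CompleteNormedModule) f); [|apply If].
    unfold plus, scal; simpl; unfold mult; simpl; ring.
  + apply (is_series_plus (K := R_AbsRing) (V := R_NormedModule)); [|exact Sg].
    apply (is_series_scal (K := R_AbsRing) (V := R_NormedModule) c), Sf.
Qed.

Lemma Rpower_root_gt1 (a : R) (m : nat) :
  1 < a -> (1 <= m)%nat -> 0 < Rpower a (1 / INR m) - 1.
Proof.
intros ha hm; apply Rlt_0_minus.
rewrite <- (Rpower_O a) at 1 by lra.
apply Rpower_lt; [exact ha|].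
apply Rdiv_lt_0_compat; [lra | now apply lt_0_INR].
Qed.

Lemma basis_poisson (a : R) (m k : nat) (x : R) :
  1 < a -> (1 <= m)%nat -> basis a m k x = poisson (rate a m x) k.
Proof.
intros ha hm; assert (H := Rpower_root_gt1 a m ha hm).
unfold basis, poisson, rate.
set (b := Rpower a (1 / INR m) - 1) in *.
f_equal.
- unfold Rpower; f_equal; field; lra.
- unfold Rdiv; rewrite !Rpow_mult_distr, pow_inv.
  field; split; [apply INR_fact_neq_0 | apply pow_nonzero; lra].
Qed.

Lemma rate_ge0 (a : R) (m : nat) (x : R) :
  1 < a -> (1 <= m)%nat -> 0 <= x -> 0 <= rate a m x.
Proof.
intros ha hm hx; assert (H := Rpower_root_gt1 a m ha hm).
assert (0 < ln a) by (rewrite <- ln_1; apply ln_increasing; lra).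
unfold rate; apply Rmult_le_pos; [nra | now apply Rlt_le, Rinv_0_lt_compat].
Qed.

(** For [0 <= x] the weights are nonnegative, so the triangle inequality on each cell and then
    comparison of series give both absolute convergence and the bound. *)
Lemma has_SMK_dominated (a : R) (m : nat) (f g : R -> R) (x lg : R) :
  1 < a -> (1 <= m)%nat -> 0 <= x ->
  (forall k, ex_RInt f (INR k / INR m) ((INR k + 1) / INR m)) ->
  (forall t, 0 <= t -> Rabs (f t) <= g t) ->
  has_SMK a m g x lg ->
  has_SMK a m f x (SMK a m f x) /\ Rabs (SMK a m f x) <= lg.
Proof.
intros ha hm hx If Hfg [Ig Sg].
assert (Hm : 0 < INR m) by now apply lt_0_INR.
assert (Hb : forall k, 0 <= basis a m k x)
  by (intros k; rewrite basis_poisson by assumption; now apply poisson_ge0, rate_ge0).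
set (u := fun k => basis a m k x * (INR m * RInt f (INR k / INR m) ((INR k + 1) / INR m))).
set (v := fun k => basis a m k x * (INR m * RInt g (INR k / INR m) ((INR k + 1) / INR m))) in Sg.
assert (Huv : forall k, Rabs (u k) <= v k).
{ intros k; unfold u, v.
  rewrite Rabs_mult, Rabs_mult, (Rabs_pos_eq _ (Hb k)), (Rabs_pos_eq (INR m)) by lra.
  apply Rmult_le_compat_l; [apply Hb|]; apply Rmult_le_compat_l; [lra|].
  assert (0 <= INR k) by apply pos_INR.
  assert (0 <= INR k / INR m) by (apply Rmult_le_pos; [|apply Rlt_le, Rinv_0_lt_compat]; lra).
  apply (norm_RInt_le f g (INR k / INR m) ((INR k + 1) / INR m)).
  - apply Rmult_le_compat_r; [apply Rlt_le, Rinv_0_lt_compat|]; lra.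
  - intros t Ht; apply Hfg; lra.
  - apply (RInt_correct (V := R_CompleteNormedModule)), If.
  - apply (RInt_correct (V := R_CompleteNormedModule)), Ig. }
assert (Ev : ex_series v) by now exists lg.
assert (Ea : ex_series (fun k => Rabs (u k))).
{ apply (ex_series_le (K := R_AbsRing) (V := R_CompleteNormedModule) _ v); [|exact Ev].
  intros k; unfold norm; simpl; unfold abs; simpl; rewrite Rabs_Rabsolu; apply Huv. }
assert (HS : has_SMK a m f x (Series u)).
{ split; [exact If|]; apply Series_correct; now apply ex_series_Rabs. }
rewrite (has_SMK_unique _ _ _ _ _ HS); split; [exact HS|].
eapply Rle_trans; [apply Series_Rabs, Ea|].
rewrite <- (is_series_unique _ _ Sg).
apply Series_le; [|exact Ev].
intros k; split; [apply Rabs_pos | apply Huv].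
Qed.

(* Moments of [t - x], as functions of the bias [b = lam/m - x], of [u = lam/m]
   and of the mesh [h = 1/m]. *)
Definition moment1 (b h : R) : R := b + h / 2.
Definition moment2 (b u h : R) : R := b ^ 2 + u * h + b * h + h ^ 2 / 3.
Definition moment4 (b u h : R) : R :=
  b ^ 4 + 6 * b ^ 2 * u * h + 4 * b * u * h ^ 2 + 3 * u ^ 2 * h ^ 2 + u * h ^ 3
  + 2 * h * (b ^ 3 + 3 * b * u * h + u * h ^ 2)
  + 2 * h ^ 2 * (b ^ 2 + u * h) + h ^ 3 * b + h ^ 4 / 5.

(** The explicit primitive [F] turns each cell average into a polynomial of degree at most four in
    [k], to which [is_series_poisson_poly4] applies. *)
Lemma has_SMK_poly (a : R) (m : nat) (x c0 c1 c2 c4 : R) :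
  1 < a -> (1 <= m)%nat ->
  let u := rate a m x / INR m in
  let h := / INR m in
  has_SMK a m
    (fun t => c0 + c1 * (t - x) + c2 * (t - x) ^ 2 + c4 * (t - x) ^ 4) x
    (c0 + c1 * moment1 (u - x) h + c2 * moment2 (u - x) u h
     + c4 * moment4 (u - x) u h).
Proof.
intros ha hm u h.
assert (Hm : 0 < INR m) by now apply lt_0_INR.
set (f := fun t => _).
pose (F := fun t => c0 * t + c1 * (t - x) ^ 2 / 2 + c2 * (t - x) ^ 3 / 3
                    + c4 * (t - x) ^ 5 / 5).
assert (If : forall k, is_RInt f (INR k / INR m) ((INR k + 1) / INR m)
  (F ((INR k + 1) / INR m) - F (INR k / INR m))).
{ intros k; apply (is_RInt_derive F f).
  - intros t _; unfold F, f; auto_derive; [exact I | field].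
  - intros t _; apply (ex_derive_continuous f); unfold f; auto_derive; exact I. }
split; [intros k; eexists; apply If|].
set (lam := rate a m x).
(* [d0] to [d4] are the coefficients of [1, k, ..., k^4] in the average over the cell of index
   [k]. *)
pose (d0 := c0 + c1 * (h / 2 - x) + c2 * (x ^ 2 - x * h + h ^ 2 / 3)
  + c4 * (x ^ 4 - 2 * x ^ 3 * h + 2 * x ^ 2 * h ^ 2 - x * h ^ 3 + h ^ 4 / 5)).
pose (d1 := h * (c1 + c2 * (h - 2 * x)
  + c4 * (-4 * x ^ 3 + 6 * x ^ 2 * h - 4 * x * h ^ 2 + h ^ 3))).
pose (d2 := h ^ 2 * (c2 + c4 * (6 * x ^ 2 - 6 * x * h + 2 * h ^ 2))).
pose (d3 := h ^ 3 * (c4 * (2 * h - 4 * x))).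
pose (d4 := h ^ 4 * c4).
match goal with |- is_series _ ?v => replace v with
  (d0 + d1 * lam + d2 * (lam ^ 2 + lam) + d3 * (lam ^ 3 + 3 * lam ^ 2 + lam)
     + d4 * (lam ^ 4 + 6 * lam ^ 3 + 7 * lam ^ 2 + lam)) end.
2:{ unfold d0, d1, d2, d3, d4, moment1, moment2, moment4, u, Rdiv.
    fold lam h; ring. }
apply is_series_ext with (2 := is_series_poisson_poly4 lam d0 d1 d2 d3 d4).
intros k; rewrite basis_poisson by assumption; fold lam; f_equal.
rewrite (is_RInt_unique _ _ _ _ (If k)).
unfold F, d0, d1, d2, d3, d4, h; field; lra.
Qed.

(** Domination applies to [f - g]; adding [g] back by linearity yields convergence for [f]. *)
Lemma has_SMK_approx (a : R) (m : nat) (f g e : R -> R) (x lg le : R) :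
  1 < a -> (1 <= m)%nat -> 0 <= x ->
  (forall k, ex_RInt f (INR k / INR m) ((INR k + 1) / INR m)) ->
  (forall t, 0 <= t -> Rabs (f t - g t) <= e t) ->
  has_SMK a m g x lg -> has_SMK a m e x le ->
  has_SMK a m f x (SMK a m f x) /\ Rabs (SMK a m f x - lg) <= le.
Proof.
intros ha hm hx If Hfg Hg He.
destruct (has_SMK_dominated a m (fun t => f t - g t) e x le ha hm hx) as [Hd Hle]; trivial.
{ intros k; apply (ex_RInt_minus (V := R_NormedModule) f g); [apply If | apply Hg]. }
assert (Hf : has_SMK a m f x (1 * SMK a m (fun t => f t - g t) x + lg)).
{ eapply has_SMK_ext; [exact (has_SMK_lin _ _ _ _ _ 1 _ _ Hd Hg) | | reflexivity].
  intros t; cbv beta; ring. }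
rewrite (has_SMK_unique _ _ _ _ _ Hf); split; [exact Hf|].
now replace (_ - lg) with (SMK a m (fun t => f t - g t) x) by ring.
Qed.

(** * Integrability and first-order expansion on the half-line *)

(** Continuity is only one-sided at 0, so [f] is replaced by its composition with [Rmax 0]: it
    agrees with [f] on the interval and is continuous on all of R, because [Rmax 0] is
    1-Lipschitz. *)
Lemma ex_RInt_half_line (f : R -> R) (c d : R) :
  (forall x, half_line x -> continue_in f half_line x) -> 0 <= c <= d -> ex_RInt f c d.
Proof.
intros Hf Hcd.
apply (ex_RInt_ext (fun t => f (Rmax 0 t))).
{ intros t Ht; rewrite Rmin_left in Ht by lra; f_equal; apply Rmax_right; lra. }
apply (ex_RInt_continuous (V := R_CompleteNormedModule)); intros z _.
apply continuity_pt_filterlim.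
intros eps Heps.
destruct (Hf (Rmax 0 z) (Rmax_l _ _) eps Heps) as [del [Hdel H]].
exists del; split; [exact Hdel|]; intros t [_ Ht]; simpl in *.
(* [continue_in] speaks only of points distinct from the base point. *)
destruct (Req_dec (Rmax 0 z) (Rmax 0 t)) as [<-|Hne].
{ now rewrite R_dist_eq. }
apply H; split; [split; [apply Rmax_l | exact Hne]|].
eapply Rle_lt_trans; [|exact Ht].
unfold R_dist, Rmax; repeat destruct Rle_dec; unfold Rabs; repeat destruct Rcase_abs; lra.
Qed.

(** Within [del] of [x], differentiability gives the [eps] term. Farther away,
    [1 <= (t - x)^2 / del^2], so quadratic growth is absorbed by the [K] term. *)
Lemma first_order_bound (f f' : R -> R) (x eps : R) :
  half_line x -> Bw f -> D_in f f' half_line x -> 0 < eps ->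
  exists K, 0 <= K /\ forall t, 0 <= t ->
    Rabs (f t - f x - f' x * (t - x)) <= eps * Rabs (t - x) + K * (t - x) ^ 2.
Proof.
intros hx [M [HM Hw]] Hd Heps.
destruct (Hd eps Heps) as [del [Hdel Hnear]]; simpl in Hnear.
(* Far from [x] the remainder is at most [A + B * (t - x)^2]: add the growth bounds at [t] and [x]
   to [Rabs (f' x) * (1 + (t - x)^2)]. *)
set (A := M * (2 + 3 * x ^ 2) + Rabs (f' x)).
set (B := 2 * M + Rabs (f' x)).
assert (HA : 0 <= A) by (unfold A; generalize (Rabs_pos (f' x)) (pow2_ge_0 x); nra).
assert (HB : 0 <= B) by (unfold B; generalize (Rabs_pos (f' x)); lra).
assert (Hdi : 0 < / del ^ 2) by (apply Rinv_0_lt_compat; nra).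
assert (HK : 0 <= A * / del ^ 2 + B) by nra.
exists (A * / del ^ 2 + B); split; [exact HK|]; intros t Ht.
assert (Hsq := pow2_ge_0 (t - x)).
destruct (Req_dec x t) as [<-|Hne].
{ replace (_ - _ - _) with 0 by ring; rewrite Rabs_R0; generalize (Rabs_pos (x - x)); nra. }
destruct (Rlt_le_dec (Rabs (t - x)) del) as [Hlt|Hge].
- assert (H : R_dist ((f t - f x) / (t - x)) (f' x) < eps).
  { apply Hnear; split; [split; [exact Ht | exact Hne] | exact Hlt]. }
  replace (f t - f x - f' x * (t - x))
    with (((f t - f x) / (t - x) - f' x) * (t - x)) by (field; lra).
  rewrite Rabs_mult; unfold R_dist in H; generalize (Rabs_pos (t - x)); nra.
- assert (Hft := Hw t Ht); assert (Hfx := Hw x hx); unfold w in *.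
  assert (H : Rabs (f t - f x - f' x * (t - x))
              <= Rabs (f t) + Rabs (f x) + Rabs (f' x) * Rabs (t - x)).
  { rewrite <- Rabs_mult; unfold Rminus.
    eapply Rle_trans; [apply Rabs_triang|]; rewrite Rabs_Ropp.
    apply Rplus_le_compat_r; eapply Rle_trans; [apply Rabs_triang|].
    rewrite Rabs_Ropp; lra. }
  assert (Hab : Rabs (t - x) <= 1 + (t - x) ^ 2)
    by (rewrite <- (pow2_abs (t - x)); nra).
  assert (Hp : Rabs (f' x) * Rabs (t - x) <= Rabs (f' x) * (1 + (t - x) ^ 2))
    by (apply Rmult_le_compat_l; [apply Rabs_pos | exact Hab]).
  (* The slack in [t^2 <= 2 x^2 + 2 (t - x)^2] is exactly [(t - 2 x)^2]. *)
  assert (Hwt : M * (1 + t ^ 2) <= M * (1 + 2 * x ^ 2 + 2 * (t - x) ^ 2))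
    by (apply Rmult_le_compat_l; [lra | generalize (pow2_ge_0 (t - 2 * x)); nra]).
  assert (H1 : 1 <= / del ^ 2 * (t - x) ^ 2).
  { rewrite <- (Rinv_l (del ^ 2)) by nra; apply Rmult_le_compat_l; [lra|].
    rewrite <- (pow2_abs (t - x)); nra. }
  assert (H2 : A * 1 <= A * (/ del ^ 2 * (t - x) ^ 2)) by now apply Rmult_le_compat_l.
  assert (0 <= eps * Rabs (t - x)) by (generalize (Rabs_pos (t - x)); nra).
  unfold A, B in *; nra.
Qed.

(** * Asymptotics of the Poisson rate and of the central moments *)

(** With [y = ln a / m], the normalised rate is [x * y / (exp y - 1)], and this quotient of [y] lies
    between [1 - y] and 1. A bias of order [1/m] vanishes even after multiplication by [sqrt m]. *)
Lemma rate_bias (a : R) (m : nat) (x : R) :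
  1 < a -> (1 <= m)%nat -> 0 <= x ->
  Rabs (rate a m x / INR m - x) <= x * ln a * / INR m.
Proof.
intros ha hm hx; assert (Hb := Rpower_root_gt1 a m ha hm).
assert (Hm : 0 < INR m) by now apply lt_0_INR.
assert (HL : 0 < ln a) by (rewrite <- ln_1; apply ln_increasing; lra).
unfold rate, Rpower in *.
set (y := ln a * / INR m).
replace (1 / INR m * ln a) with y in * by (unfold y; field; lra).
assert (Hy : 0 < y) by (apply Rmult_lt_0_compat; [|apply Rinv_0_lt_compat]; lra).
(* exp (-y) <= y / (exp y - 1) <= 1 *)
assert (H1 := exp_ineq1_le y); assert (H2 := exp_ineq1_le (- y)).
assert (H3 : exp (- y) * exp y = 1) by (rewrite <- exp_plus, Rplus_opp_l; apply exp_0).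
set (q := y / (exp y - 1)).
assert (Hq : q * (exp y - 1) = y) by (unfold q; field; lra).
assert (Hq1 : q <= 1) by nra.
(* Multiplying [H2] by [exp y] gives [(1 - y) * exp y <= 1]. *)
assert (Hq2 : 1 - y <= q).
{ apply Rmult_le_reg_r with (exp y - 1); [lra|]; rewrite Hq; nra. }
replace (x * ln a / (exp y - 1) / INR m - x) with (- (x * (1 - q)))
  by (unfold q, y; field; fold y; lra).
replace (x * ln a * / INR m) with (x * y) by (unfold y; ring).
rewrite Rabs_Ropp, Rabs_pos_eq by nra; nra.
Qed.

(** [K] may blow up as [eps] shrinks, but [eps] is fixed before [n] grows: [z] then kills the [K]
    term, and [b], being convergent, stays bounded. *)
Lemma is_lim_seq_approx (u v b z : nat -> R) (l lb : R) :
  is_lim_seq v l -> is_lim_seq b lb -> is_lim_seq z 0 ->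
  (forall eps, 0 < eps <= 1 ->
     exists K, forall n, Rabs (u n - v n) <= eps * b n + K * z n) ->
  is_lim_seq u l.
Proof.
intros Hv Hb Hz H.
apply (is_lim_seq_ext (fun n => v n + (u n - v n))); [intros n; ring|].
replace (Finite l) with (Finite (l + 0)) by (f_equal; ring).
apply is_lim_seq_plus'; [exact Hv|].
apply is_lim_seq_spec; intros [eps Heps]; simpl.
(* Eventually [b n <= Rabs lb + 1], so this choice makes [e * b n] at most [eps / 2]. *)
set (e := Rmin 1 (eps / (2 * (Rabs lb + 1)))).
assert (Hlb := Rabs_pos lb).
assert (He : 0 < e).
{ apply Rmin_glb_lt; [lra|]; apply Rdiv_lt_0_compat; lra. }
assert (He' : e * (Rabs lb + 1) <= eps / 2).
{ apply Rle_trans with (eps / (2 * (Rabs lb + 1)) * (Rabs lb + 1)).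
  - apply Rmult_le_compat_r; [lra | apply Rmin_r].
  - right; field; lra. }
destruct (H e (conj He (Rmin_l _ _))) as [K HK].
assert (HKz : is_lim_seq (fun n => K * z n) 0).
{ replace (Finite 0) with (Finite (K * 0)) by (f_equal; ring).
  now apply (is_lim_seq_mult' _ _ _ _ (is_lim_seq_const K)). }
apply is_lim_seq_spec in HKz; apply is_lim_seq_spec in Hb.
assert (Heps2 : 0 < eps / 2) by lra.
destruct (HKz (mkposreal _ Heps2)) as [N1 H1].
destruct (Hb (mkposreal _ Rlt_0_1)) as [N2 H2]; simpl in H1, H2.
exists (max N1 N2); intros n Hn.
specialize (H1 n ltac:(lia)); specialize (H2 n ltac:(lia)); specialize (HK n).
rewrite Rminus_0_r in *.
apply Rabs_lt_between in H1; apply Rabs_lt_between in H2.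
assert (e * b n <= e * (Rabs lb + 1))
  by (apply Rmult_le_compat_l; [lra | generalize (Rle_abs lb); lra]).
lra.
Qed.

Lemma is_lim_seq_inv_S : is_lim_seq (fun n => / INR (S n)) 0.
Proof.
apply is_lim_seq_incr_1 with (u := fun n => / INR n).
apply (is_lim_seq_inv INR p_infty is_lim_seq_INR); discriminate.
Qed.

Lemma is_lim_seq_inv_sqrt_S : is_lim_seq (fun n => / sqrt (INR (S n))) 0.
Proof.
apply (is_lim_seq_ext (fun n => sqrt (/ INR (S n)))).
{ intros n; apply sqrt_inv. }
rewrite <- sqrt_0.
apply (is_lim_seq_continuous sqrt); [|apply is_lim_seq_inv_S].
apply continuity_pt_sqrt; lra.
Qed.

(** Usually run with the limit left as an existential variable; the value it builds is then compared
    with the expected one by [ring]. *)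
Ltac poly_lim :=
  repeat first [eassumption | apply is_lim_seq_const
               | apply is_lim_seq_plus' | apply is_lim_seq_mult'].

Lemma is_lim_seq_eq (u : nat -> R) (l l' : R) :
  is_lim_seq u l' -> l' = l -> is_lim_seq u l.
Proof. now intros H <-. Qed.

Lemma is_lim_seq_ext_eq (u v : nat -> R) (l l' : R) :
  is_lim_seq v l' -> (forall n, v n = u n) -> l' = l -> is_lim_seq u l.
Proof. intros H E <-; now apply (is_lim_seq_ext v). Qed.

(** Here [b] is of order [h] and [u] tends to [x]. In [moment2] only [u * h] has order [h]; every
    term of [moment4] has order at least [h^2]. *)
Lemma moment_limits (a x : R) :
  1 < a -> 0 <= x ->
  let u n := rate a (S n) x / INR (S n) in
  let h n := / INR (S n) in
  is_lim_seq (fun n => sqrt (INR (S n)) * moment1 (u n - x) (h n)) 0 /\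
  is_lim_seq (fun n => INR (S n) * moment2 (u n - x) (u n) (h n)) x /\
  is_lim_seq (fun n => INR (S n) * moment4 (u n - x) (u n) (h n)) 0.
Proof.
intros ha hx u h.
(* In the second and fourth moments the factor [m] cancels an explicit [h] except in the pure powers
   of [b]; [q] handles those. *)
pose (b n := u n - x); pose (q n := INR (S n) * (b n * b n)).
pose (r n := / sqrt (INR (S n))).
set (C := x * ln a).
assert (HM : forall n, 0 < INR (S n)) by (intros n; apply lt_0_INR; lia).
assert (Hbias : forall n, Rabs (b n) <= C * h n).
{ intros n; apply rate_bias; [exact ha | lia | exact hx]. }
assert (Hh : is_lim_seq h 0) by exact is_lim_seq_inv_S.
assert (Hr : is_lim_seq r 0) by exact is_lim_seq_inv_sqrt_S.
assert (squeeze : forall s t : nat -> R, is_lim_seq t 0 ->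
  (forall n, Rabs (s n) <= t n) -> is_lim_seq s 0).
{ intros s t Ht Hst; apply is_lim_seq_abs_0.
  apply (is_lim_seq_le_le (fun _ => 0) _ t); [|apply is_lim_seq_const | exact Ht].
  intros n; split; [apply Rabs_pos | apply Hst]. }
assert (Hb : is_lim_seq b 0).
{ apply (squeeze _ (fun n => C * h n)); [|exact Hbias].
  eapply is_lim_seq_eq; [poly_lim | ring]. }
assert (Hq : is_lim_seq q 0).
{ apply (squeeze _ (fun n => C * C * h n)).
  { eapply is_lim_seq_eq; [poly_lim | ring]. }
  intros n; unfold q; rewrite Rabs_mult, Rabs_mult, (Rabs_pos_eq (INR _))
    by apply Rlt_le, HM.
  replace (C * C * h n) with (INR (S n) * ((C * h n) * (C * h n)))
    by (unfold h; field; apply Rgt_not_eq, HM).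
  apply Rmult_le_compat_l; [apply Rlt_le, HM|].
  apply Rmult_le_compat; try apply Rabs_pos; apply Hbias. }
assert (Hu : is_lim_seq u x).
{ apply (is_lim_seq_ext_eq _ (fun n => x + b n) _ (x + 0)); [poly_lim | | ring].
  intros n; unfold b; ring. }
split; [|split].
- apply (squeeze _ (fun n => (C + 1 / 2) * r n)).
  { eapply is_lim_seq_eq; [poly_lim | ring]. }
  intros n; fold (b n).
  assert (Hs : 0 < sqrt (INR (S n))) by apply sqrt_lt_R0, HM.
  assert (Hss : sqrt (INR (S n)) * sqrt (INR (S n)) = INR (S n))
    by apply sqrt_sqrt, Rlt_le, HM.
  assert (Hrh : r n = sqrt (INR (S n)) * h n).
  { assert (HMn := HM n); apply Rmult_eq_reg_l with (sqrt (INR (S n))); [|lra].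
    rewrite <- Rmult_assoc, Hss; unfold r, h; rewrite !Rinv_r; lra. }
  rewrite Rabs_mult, (Rabs_pos_eq (sqrt _)), Hrh by lra.
  replace ((C + 1 / 2) * (sqrt (INR (S n)) * h n))
    with (sqrt (INR (S n)) * ((C + 1 / 2) * h n)) by ring.
  apply Rmult_le_compat_l; [lra|]; unfold moment1.
  eapply Rle_trans; [apply Rabs_triang|].
  assert (0 < h n) by apply Rinv_0_lt_compat, HM.
  rewrite (Rabs_pos_eq (h n / 2)) by lra.
  generalize (Hbias n); lra.
- apply (is_lim_seq_ext_eq _ (fun n => q n + u n + b n + h n * / 3) _ (0 + x + 0 + 0 * / 3));
    [poly_lim | | ring].
  intros n; fold (b n); unfold q, moment2, h; field; apply Rgt_not_eq, HM.
- eapply (is_lim_seq_ext_eq _ (fun n => q n * (b n * b n) + 6 * (b n * b n) * u n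
    + 4 * b n * u n * h n + 3 * (u n * u n) * h n + u n * (h n * h n)
    + 2 * (b n * b n * b n + 3 * b n * u n * h n + u n * (h n * h n))
    + 2 * h n * (b n * b n + u n * h n) + h n * h n * b n + h n * h n * h n * / 5));
    [poly_lim | | ring].
  intros n; fold (b n); unfold q, moment4, h; field; apply Rgt_not_eq, HM.
Qed.

(** * The operator on increments and on their products *)

(** The error bound uses only even powers, whose moments are explicit; [e0] leaves room for trading
    [|t - x|] against a constant and a square. *)
Lemma SMK_approx_poly (a : R) (m : nat) (f : R -> R) (x c1 c2 e0 e2 e4 : R) :
  1 < a -> (1 <= m)%nat -> 0 <= x ->
  (forall t, half_line t -> continue_in f half_line t) ->
  (forall t, 0 <= t -> Rabs (f t - (c1 * (t - x) + c2 * (t - x) ^ 2))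
                       <= e0 + e2 * (t - x) ^ 2 + e4 * (t - x) ^ 4) ->
  let u := rate a m x / INR m in
  let h := / INR m in
  has_SMK a m f x (SMK a m f x) /\
  Rabs (SMK a m f x - (c1 * moment1 (u - x) h + c2 * moment2 (u - x) u h))
    <= e0 + e2 * moment2 (u - x) u h + e4 * moment4 (u - x) u h.
Proof.
intros ha hm hx hf Hf u h.
assert (Hm : 0 < INR m) by now apply lt_0_INR.
eapply has_SMK_approx; [exact ha | exact hm | exact hx | | exact Hf | |].
- intros k; apply ex_RInt_half_line; [exact hf|].
  assert (0 <= INR k) by apply pos_INR; assert (0 < / INR m) by now apply Rinv_0_lt_compat.
  unfold Rdiv; nra.
- eapply has_SMK_ext; [apply (has_SMK_poly a m x 0 c1 c2 0 ha hm) | |].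
  + intros t; cbv beta; ring.
  + fold u h; ring.
- eapply has_SMK_ext; [apply (has_SMK_poly a m x e0 0 e2 e4 ha hm) | |].
  + intros t; cbv beta; ring.
  + fold u h; ring.
Qed.

Lemma continue_in_sub_const (f : R -> R) (D : R -> Prop) (x c : R) :
  continue_in f D x -> continue_in (fun t => f t - c) D x.
Proof.
intros H; apply limit_minus with (1 := H); exact (limit_free (fun _ => c) _ c x).
Qed.

(** In [|d| <= s d^2 + 1/s] the choice [s = sqrt m] balances both terms: after multiplication by
    [sqrt m] they become [m E d^2 + 1], which is bounded and carries the factor [eps]. *)
Lemma SMK_increment (a : R) (f f' : R -> R) (x : R) :
  1 < a -> 0 <= x -> Cw f -> D_in f f' half_line x ->
  (forall m, (1 <= m)%nat ->
     has_SMK a m (fun t => f t - f x) x (SMK a m (fun t => f t - f x) x)) /\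
  is_lim_seq (fun n => sqrt (INR (S n)) * SMK a (S n) (fun t => f t - f x) x) 0.
Proof.
intros ha hx [hB hC] hd.
assert (hc : forall t, half_line t -> continue_in (fun s => f s - f x) half_line t)
  by (intros t Ht; now apply continue_in_sub_const, hC).
(* [s] stays free: 1 suffices for convergence, [sqrt m] serves for the limit. [K] is chosen before
   both [m] and [s]. *)
assert (bound : forall eps, 0 < eps -> exists K, forall m s, (1 <= m)%nat -> 0 < s ->
  let u := rate a m x / INR m in let h := / INR m in
  has_SMK a m (fun t => f t - f x) x (SMK a m (fun t => f t - f x) x) /\
  Rabs (SMK a m (fun t => f t - f x) x - f' x * moment1 (u - x) h)
    <= eps * (s * moment2 (u - x) u h + / s) + K * moment2 (u - x) u h).
{ intros eps Heps.
  destruct (first_order_bound f f' x eps hx hB hd Heps) as [K [HK Hf]].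
  exists K; intros m s hm hs u h.
  destruct (SMK_approx_poly a m _ x (f' x) 0 (eps * / s) (eps * s + K) 0 ha hm hx hc)
    as [H1 H2].
  - intros t Ht.
    replace (f t - f x - (f' x * (t - x) + 0 * (t - x) ^ 2))
      with (f t - f x - f' x * (t - x)) by ring.
    eapply Rle_trans; [apply (Hf t Ht)|].
    (* AM-GM: [|d| <= s d^2 + 1/s] *)
    assert (Rabs (t - x) <= s * (t - x) ^ 2 + / s).
    { rewrite <- (pow2_abs (t - x)); set (d := Rabs (t - x)).
      assert (0 < / s) by now apply Rinv_0_lt_compat.
      assert (s * / s = 1) by (field; lra).
      assert (0 <= / s * (s * d - / 2) ^ 2)
        by (apply Rmult_le_pos; [lra | apply pow2_ge_0]).
      replace (/ s * (s * d - / 2) ^ 2) with (s * d ^ 2 - d + / s / 4) in * by (field; lra).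
      lra. }
    nra.
  - split; [exact H1|]; fold u h in H2.
    replace (f' x * moment1 (u - x) h)
      with (f' x * moment1 (u - x) h + 0 * moment2 (u - x) u h) by ring.
    eapply Rle_trans; [exact H2|]; right; ring. }
split.
{ destruct (bound 1 Rlt_0_1) as [K HK]; intros m hm; apply (HK m 1 hm Rlt_0_1). }
destruct (moment_limits a x ha hx) as [L1 [L2 _]]; cbv zeta in L1, L2.
pose (m1 n := moment1 (rate a (S n) x / INR (S n) - x) (/ INR (S n))).
pose (m2 n := moment2 (rate a (S n) x / INR (S n) - x) (rate a (S n) x / INR (S n))
                (/ INR (S n))).
change (is_lim_seq (fun n => sqrt (INR (S n)) * m1 n) 0) in L1.
change (is_lim_seq (fun n => INR (S n) * m2 n) x) in L2.
assert (Hr := is_lim_seq_inv_sqrt_S).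
apply (is_lim_seq_approx _ (fun n => f' x * (sqrt (INR (S n)) * m1 n))
  (fun n => INR (S n) * m2 n + 1) (fun n => / sqrt (INR (S n)) * (INR (S n) * m2 n)) 0 (x + 1)).
- eapply is_lim_seq_eq; [poly_lim | ring].
- poly_lim.
- eapply is_lim_seq_eq; [poly_lim | ring].
- intros eps [Heps _]; destruct (bound eps Heps) as [K HK]; exists K; intros n.
  assert (HM : 0 < INR (S n)) by (apply lt_0_INR; lia).
  set (s := sqrt (INR (S n))).
  assert (Hs : 0 < s) by now apply sqrt_lt_R0.
  assert (Hss : INR (S n) = s * s) by (symmetry; apply sqrt_sqrt; lra).
  destruct (HK (S n) s ltac:(lia) Hs) as [_ H]; fold (m1 n) (m2 n) in H.
  replace (_ - _) with (s * (SMK a (S n) (fun t => f t - f x) x - f' x * m1 n)) by ring.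
  rewrite Rabs_mult, (Rabs_pos_eq s) by lra.
  eapply Rle_trans; [apply Rmult_le_compat_l; [lra | exact H]|].
  right; rewrite Hss; field; lra.
Qed.

(** Expanding the product around [p d] and [q d] leaves errors in [d^2], [d^3] and [d^4]. The square
    carries a factor [eps], and the cube is split between its neighbours. *)
Lemma SMK_increment_product (a : R) (f f' g g' : R -> R) (x : R) :
  1 < a -> 0 <= x -> Cw f -> Cw g ->
  D_in f f' half_line x -> D_in g g' half_line x ->
  let P := fun t => (f t - f x) * (g t - g x) in
  (forall m, (1 <= m)%nat -> has_SMK a m P x (SMK a m P x)) /\
  is_lim_seq (fun n => INR (S n) * SMK a (S n) P x) (x * f' x * g' x).
Proof.
intros ha hx [hBf hCf] [hBg hCg] hdf hdg P.
assert (hc : forall t, half_line t -> continue_in P half_line t).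
{ intros t Ht; apply (limit_mul (fun t => f t - f x) (fun t => g t - g x));
    apply continue_in_sub_const; auto. }
set (p := f' x) in *; set (q := g' x) in *.
(* The 2 pays for [eps * eps <= eps] and for the [eps * d^2] spent on the cubic term. *)
set (B := Rabs p + Rabs q + 2).
assert (HB : 2 <= B) by (unfold B; generalize (Rabs_pos p) (Rabs_pos q); lra).
assert (bound : forall eps, 0 < eps <= 1 -> exists K, forall t, 0 <= t ->
  Rabs (P t - p * q * (t - x) ^ 2) <= eps * B * (t - x) ^ 2 + K * (t - x) ^ 4).
{ intros eps [Heps Heps1].
  destruct (first_order_bound f f' x eps hx hBf hdf Heps) as [K1 [HK1 Hf]].
  destruct (first_order_bound g g' x eps hx hBg hdg Heps) as [K2 [HK2 Hg]].
  (* [C] is the coefficient of [d^3] in the expanded error bound. *)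
  set (C := K1 * (Rabs q + eps) + (eps + Rabs p) * K2).
  exists (K1 * K2 + C ^ 2 / (4 * eps)); intros t Ht.
  specialize (Hf t Ht); specialize (Hg t Ht); fold p in Hf; fold q in Hg.
  set (y := t - x) in *; set (F := f t - f x) in *; set (G := g t - g x) in *.
  change (P t) with (F * G).
  replace (F * G - p * q * y ^ 2)
    with ((F - p * y) * (G - q * y) + (F - p * y) * (q * y) + (p * y) * (G - q * y)) by ring.
  eapply Rle_trans; [apply Rabs_triang|].
  eapply Rle_trans; [apply Rplus_le_compat_r, Rabs_triang|].
  rewrite !Rabs_mult.
  replace (y ^ 4) with ((y ^ 2) ^ 2) by ring.
  rewrite <- (pow2_abs y) in *.
  assert (Hp := Rabs_pos p); assert (Hq := Rabs_pos q); assert (Hy := Rabs_pos y).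
  set (d := Rabs y) in *; set (p' := Rabs p) in *; set (q' := Rabs q) in *.
  set (E1 := eps * d + K1 * d ^ 2) in *; set (E2 := eps * d + K2 * d ^ 2) in *.
  apply Rle_trans with (E1 * E2 + E1 * (q' * d) + p' * d * E2).
  { assert (0 <= q' * d) by now apply Rmult_le_pos.
    assert (0 <= p' * d) by now apply Rmult_le_pos.
    repeat apply Rplus_le_compat.
    - apply Rmult_le_compat; trivial; apply Rabs_pos.
    - now apply Rmult_le_compat_r.
    - now apply Rmult_le_compat_l. }
  (* AM-GM: [C d^3 <= eps d^2 + C^2 d^4 / (4 eps)] *)
  assert (Hamgm : C * d ^ 3 <= eps * d ^ 2 + C ^ 2 / (4 * eps) * d ^ 4).
  { assert (0 <= / eps * (d * (eps - C * d / 2)) ^ 2)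
      by (apply Rmult_le_pos; [now apply Rlt_le, Rinv_0_lt_compat | apply pow2_ge_0]).
    replace (/ eps * (d * (eps - C * d / 2)) ^ 2)
      with (eps * d ^ 2 + C ^ 2 / (4 * eps) * d ^ 4 - C * d ^ 3) in * by (field; lra).
    lra. }
  assert (Heq : E1 * E2 + E1 * (q' * d) + p' * d * E2
    = eps * (eps + q' + p') * d ^ 2 + C * d ^ 3 + K1 * K2 * d ^ 4)
    by (unfold E1, E2, C; ring).
  assert (0 <= eps * (1 - eps) * d ^ 2)
    by (apply Rmult_le_pos; [nra | apply pow2_ge_0]).
  rewrite Heq; unfold B; nra. }
assert (HS : forall eps, 0 < eps <= 1 -> exists K, forall m, (1 <= m)%nat ->
  let u := rate a m x / INR m in let h := / INR m in
  has_SMK a m P x (SMK a m P x) /\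
  Rabs (SMK a m P x - p * q * moment2 (u - x) u h)
    <= eps * B * moment2 (u - x) u h + K * moment4 (u - x) u h).
{ intros eps Heps; destruct (bound eps Heps) as [K HK]; exists K; intros m hm u h.
  destruct (SMK_approx_poly a m P x 0 (p * q) 0 (eps * B) K ha hm hx hc) as [H1 H2].
  - intros t Ht; rewrite Rmult_0_l, !Rplus_0_l; now apply HK.
  - split; [exact H1|]; fold u h in H2; now rewrite Rmult_0_l, !Rplus_0_l in H2. }
split.
{ destruct (HS 1 ltac:(lra)) as [K HK]; intros m hm; apply (HK m hm). }
destruct (moment_limits a x ha hx) as [_ [L2 L4]]; cbv zeta in L2, L4.
pose (m2 n := moment2 (rate a (S n) x / INR (S n) - x) (rate a (S n) x / INR (S n))
                (/ INR (S n))).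
pose (m4 n := moment4 (rate a (S n) x / INR (S n) - x) (rate a (S n) x / INR (S n))
                (/ INR (S n))).
change (is_lim_seq (fun n => INR (S n) * m2 n) x) in L2.
change (is_lim_seq (fun n => INR (S n) * m4 n) 0) in L4.
apply (is_lim_seq_approx _ (fun n => p * q * (INR (S n) * m2 n))
  (fun n => B * (INR (S n) * m2 n)) (fun n => INR (S n) * m4 n) _ (B * x)).
- eapply is_lim_seq_eq; [poly_lim | ring].
- poly_lim.
- exact L4.
- intros eps Heps; destruct (HS eps Heps) as [K HK]; exists K; intros n.
  assert (HM : 0 < INR (S n)) by (apply lt_0_INR; lia).
  destruct (HK (S n) ltac:(lia)) as [_ H]; fold (m2 n) (m4 n) in H.
  replace (_ - _) with (INR (S n) * (SMK a (S n) P x - p * q * m2 n)) by ring.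
  rewrite Rabs_mult, (Rabs_pos_eq (INR _)) by lra.
  eapply Rle_trans; [apply Rmult_le_compat_l; [lra | exact H]|].
  right; ring.
Qed.

(** * From increments to the covariance *)

Theorem theorem4p2 (a : R) (ha : 1 < a)
  (mu mu' mu'' nu nu' nu'' : R -> R)
  (hmu : Cwk mu) (hnu : Cwk nu)
  (dmu : derivative_on_half_line mu mu')
  (ddmu : derivative_on_half_line mu' mu'')
  (dnu : derivative_on_half_line nu nu')
  (ddnu : derivative_on_half_line nu' nu'')
  (hmu' : Cwk mu') (hmu'' : Cwk mu'')
  (hnu' : Cwk nu') (hnu'' : Cwk nu'')
  (x : R) (hx : 0 <= x) :
  is_lim_seq
    (fun m : nat =>
       INR m * (SMK a m (fun t : R => mu t * nu t) x
                - SMK a m mu x * SMK a m nu x))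
    (Finite (x * mu' x * nu' x)).
Proof.
destruct (SMK_increment a mu mu' x ha hx (proj1 hmu) (dmu x hx)) as [SF LF].
destruct (SMK_increment a nu nu' x ha hx (proj1 hnu) (dnu x hx)) as [SG LG].
destruct (SMK_increment_product a mu mu' nu nu' x ha hx (proj1 hmu) (proj1 hnu)
            (dmu x hx) (dnu x hx)) as [SP LP]; cbv zeta in SP, LP.
(* The shift discards the meaningless index [m = 0]. *)
apply is_lim_seq_incr_1.
assert (L := is_lim_seq_minus' _ _ _ _ LP (is_lim_seq_mult' _ _ _ _ LF LG)).
eapply is_lim_seq_ext_eq; [exact L | | ring].
intros n; cbv beta.
specialize (SF (S n) ltac:(lia)); specialize (SG (S n) ltac:(lia));
  specialize (SP (S n) ltac:(lia)).
set (F := SMK a (S n) (fun t => mu t - mu x) x) in *.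
set (G := SMK a (S n) (fun t => nu t - nu x) x) in *.
set (P := SMK a (S n) (fun t => (mu t - mu x) * (nu t - nu x)) x) in *.
(* Constants are reproduced because the operator has total mass one. *)
assert (S1 : forall c, has_SMK a (S n) (fun _ => c) x c).
{ intros c; eapply has_SMK_ext; [apply (has_SMK_poly a (S n) x c 0 0 0 ha); lia | |];
    [intros t; cbv beta|]; ring. }
assert (Emu : SMK a (S n) mu x = F + mu x).
{ apply has_SMK_unique; eapply has_SMK_ext; [apply (has_SMK_lin _ _ _ _ _ 1 _ _ SF (S1 (mu x)))| |];
    [intros t; cbv beta|]; ring. }
assert (Enu : SMK a (S n) nu x = G + nu x).
{ apply has_SMK_unique; eapply has_SMK_ext; [apply (has_SMK_lin _ _ _ _ _ 1 _ _ SG (S1 (nu x)))| |];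
    [intros t; cbv beta|]; ring. }
(* Expanding [mu * nu] around the values at [x] produces the same linear terms as the product of the
   two means, so the covariance reduces to [P - F * G]. *)
assert (Emn : SMK a (S n) (fun t => mu t * nu t) x = P + nu x * F + mu x * G + mu x * nu x).
{ apply has_SMK_unique; eapply has_SMK_ext.
  - exact (has_SMK_lin _ _ _ _ _ 1 _ _ SP (has_SMK_lin _ _ _ _ _ (nu x) _ _ SF
      (has_SMK_lin _ _ _ _ _ (mu x) _ _ SG (S1 (mu x * nu x))))).
  - intros t; cbv beta; ring.
  - ring. }
rewrite Emu, Enu, Emn.
replace (sqrt (INR (S n)) * F * (sqrt (INR (S n)) * G)) with (INR (S n) * (F * G)); [ring|].
rewrite <- (sqrt_sqrt (INR (S n))) at 1 by apply pos_INR; ring.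
Qed.
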